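(* For every $\varepsilon>0$ there exists an integer $d_\varepsilon$ such that for all integers $d\ge d_\varepsilon$ and $N\ge 1$, and every point $\mathbf a\in\mathcal W(d,N)$, the proportion of triangles $(\mathbf a,\mathbf v_1,\mathbf v_2)$ with $\mathbf v_1,\mathbf v_2\in\mathcal V(d,N)$ such that $$\bigl|\operatorname{dist}_d(\mathbf a,\mathbf v_1)-\operatorname{dist}_d(\mathbf a,\mathbf v_2)\bigr|\le\varepsilon$$ is at least $1-\varepsilon$.
   Context: For integers $d,N\ge1$, $\mathcal W=\mathcal W(d,N)=\{0,1,\dots,N\}^d$ is the set of lattice points of the hypercube $[0,N]^d$, and $\mathcal V=\mathcal V(d,N)=\{0,N\}^d$ is the set of its $2^d$ vertices. For $\mathbf u,\mathbf v\in\mathbb R^d$ the normalized distance is $\operatorname{dist}_d(\mathbf u,\mathbf v)=\frac{1}{\sqrt d\,N}\bigl(\sum_{j=1}^d(u_j-v_j)^2\bigr)^{1/2}$. Triangles $(\mathbf a,\mathbf v_1,\mathbf v_2)$ are counted as pairs $(\mathbf v_1,\mathbf v_2)\in\mathcal V^2$ forming with $\mathbf a$ a triangle. *)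

(* Defs.v *)
From HB Require Import structures.
From mathcomp Require Export all_boot all_order all_algebra.
From mathcomp Require Export reals.

Set Implicit Arguments.
Unset Strict Implicit.
Unset Printing Implicit Defensive.

Export Order.TTheory GRing.Theory Num.Theory.

Local Open Scope ring_scope.

(* The lattice points {0, ..., N}^d, as a finite type; [point] below embeds
   them in R^d. *)
Definition lattice (d N : nat) : finType := 'rV['I_N.+1]_d.

Definition vertices (d N : nat) : {set lattice d N} :=
  [set v : lattice d N |
    [forall j, (v ord0 j == ord0) || (v ord0 j == ord_max)]].

Definition point (R : realType) (d N : nat) (w : lattice d N) : 'rV[R]_d :=
  \row_j (w ord0 j : nat)%:R.

Definition ndist (R : realType) (d N : nat) (u v : 'rV[R]_d) : R :=
  (Num.sqrt d%:R * N%:R)^-1 *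
  Num.sqrt (\sum_(j < d) (u ord0 j - v ord0 j) ^+ 2).

(* Three points form a triangle when they are not collinear, that is, when the
   two edge vectors issued from [a] are linearly independent. *)
Definition is_triangle (R : realType) (d : nat) (a u v : 'rV[R]_d) : bool :=
  row_free (col_mx (u - a) (v - a)).

Definition triangles (R : realType) (d N : nat) (a : lattice d N) :
    {set lattice d N * lattice d N} :=
  [set p in setX (vertices d N) (vertices d N) |
    is_triangle (point R a) (point R p.1) (point R p.2)].

Definition near_isosceles (R : realType) (d N : nat) (a : lattice d N)
    (eps : R) : {set lattice d N * lattice d N} :=
  [set p in triangles R a |
    `|ndist N (point R a) (point R p.1) - ndist N (point R a) (point R p.2)|
      <= eps].

Definition proportion (R : realType) (T : finType) (A B : {set T}) : R :=
  #|A|%:R / #|B|%:R.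

(* Main.v *)
(** The squared distance from [a] to a random vertex is a sum of [d]
    independent terms, each of variance at most [N ^ 4 / 4].  By Chebyshev, two
    random vertices have squared distances to [a] that differ by more than
    [eps ^ 2 * d * N ^ 2] with probability at most [1 / (d * eps ^ 4)]; since
    [(sqrt x - sqrt y) ^ 2 <= |x - y|], the normalized distances are otherwise
    within [eps].  Degenerate triangles are negligible: a line contains at most
    two vertices of the cube, so they number at most [3 * 2 ^ d] out of
    [4 ^ d] pairs. *)

Require Import Defs.
From mathcomp Require Import all_boot all_order all_algebra.
From mathcomp Require Import reals.
From mathcomp Require Import ring lra zify.

Set Implicit Arguments.
Unset Strict Implicit.
Unset Printing Implicit Defensive.

Local Open Scope ring_scope.

(** * Random signs and auxiliary inequalities *)

Lemma sum_signM_eq0 (R : numDomainType) (I : finType) (i j : I) : i != j ->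
  \sum_(b : {ffun I -> bool}) (-1) ^+ b i * (-1) ^+ b j = 0 :> R.
Proof.
move=> neq_ij; set s := LHS.
(* Flipping the bit at [i] permutes the sign patterns and negates every summand, so the sum equals
   its own opposite. *)
pose flip (b : {ffun I -> bool}) := [ffun k => (k == i) (+) b k].
have flipK : involutive flip.
  by move=> b; apply/ffunP=> k; rewrite !ffunE addbA addbb.
suff: s = - s by move/eqP; rewrite -addr_eq0 -mulr2n mulrn_eq0 => /eqP.
rewrite {1}/s (reindex_inj (inv_inj flipK)) /= -sumrN; apply: eq_bigr => b _.
by rewrite !ffunE eqxx eq_sym (negPf neq_ij) /= signrN mulNr.
Qed.

(** Second moment of a random signed sum: once the square is expanded, the cross terms cancel by
    [sum_signM_eq0]. *)
Lemma sum_sqr_signed_sum (R : numDomainType) (I : finType) (c : I -> R) :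
  \sum_(b : {ffun I -> bool}) (\sum_i c i * (-1) ^+ b i) ^+ 2 =
  (2 ^ #|I|)%:R * \sum_i c i ^+ 2.
Proof.
under eq_bigr do rewrite expr2 big_distrlr /=.
rewrite exchange_big mulr_sumr; apply: eq_bigr => i _.
rewrite exchange_big (bigD1 i) //= [X in _ + X]big1 ?addr0 => [|j neq_ji].
  under eq_bigr => b _ do rewrite mulrACA -signr_addb addbb mulr1 -expr2.
  by rewrite sumr_const card_ffun card_bool mulr_natl.
under eq_bigr => b _ do rewrite mulrACA.
by rewrite -mulr_sumr sum_signM_eq0 ?mulr0 // eq_sym.
Qed.

(** Factor [x - y] as a difference of squares and bound one factor by the difference of the roots
    being at most their sum. *)
Lemma sqr_sqrt_sub_le (R : rcfType) (x y : R) : 0 <= x -> 0 <= y ->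
  (Num.sqrt x - Num.sqrt y) ^+ 2 <= `|x - y|.
Proof.
move=> x_ge0 y_ge0.
rewrite -{2}(sqr_sqrtr x_ge0) -{2}(sqr_sqrtr y_ge0) subr_sqr normrM.
rewrite -real_normK ?num_real // expr2 ler_wpM2l //.
apply: le_trans (ler_normB _ _) _.
by rewrite !ger0_norm ?addr_ge0 ?sqrtr_ge0.
Qed.

Lemma dependent_rV_scale (F : fieldType) (n : nat) (u v : 'rV[F]_n) :
  u != 0 -> ~~ row_free (col_mx u v) -> exists k, v = k *: u.
Proof.
move=> u_neq0 not_free; apply/sub_rVP; apply: contraNT not_free => not_sub.
have sub_u : (u <= col_mx u v)%MS.
  by have := submx_refl (col_mx u v); rewrite col_mx_sub => /andP[].
have := ltn_leqif (mxrank_leqif_sup sub_u).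
rewrite col_mx_sub submx_refl (negPf not_sub) rank_rV u_neq0 /= => rank_gt1.
by rewrite /row_free eqn_leq rank_leq_row.
Qed.

(** * Vertices of the cube as sign patterns *)

Section Vertices.
Variables d N : nat.
Hypothesis N_gt0 : (0 < N)%N.

Definition vertex (b : {ffun 'I_d -> bool}) : lattice d N :=
  \row_j if b j then ord_max else ord0.

Lemma vertex_inj : injective vertex.
Proof.
move=> b1 b2 /rowP eqb; apply/ffunP => j; have := congr1 val (eqb j).
rewrite !mxE; case: (b1 j); case: (b2 j) => //= N0; move: N_gt0.
  by rewrite N0.
by rewrite -N0.
Qed.

Lemma verticesE : vertices d N = [set vertex b | b in setT].
Proof.
apply/setP=> v; rewrite inE; apply/forallP/imsetP => [v01|[b _ ->] j].
  exists [ffun j => v ord0 j == ord_max] => //; apply/rowP=> j.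
  rewrite mxE ffunE; case: eqP => // v_max.
  by have /orP[/eqP|/eqP] := v01 j.
by rewrite mxE; case: (b j); rewrite eqxx ?orbT.
Qed.

Lemma card_vertices : #|vertices d N| = (2 ^ d)%N.
Proof.
by rewrite verticesE card_imset ?cardsT ?card_ffun ?card_bool ?card_ord //;
  exact: vertex_inj.
Qed.

Lemma sum_vertices (R : nmodType) (F : lattice d N -> R) :
  \sum_(v in vertices d N) F v = \sum_b F (vertex b).
Proof.
rewrite verticesE big_imset /=; last by move=> ? ? _ _; exact: vertex_inj.
by apply: eq_bigl => b; rewrite inE.
Qed.

(** * Second moment of the squared distance from [a] to a vertex *)

Variables (R : realType) (a : lattice d N).

Definition sqdist (v : lattice d N) : R :=
  \sum_j (point R a ord0 j - point R v ord0 j) ^+ 2.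

Let x (j : 'I_d) : R := (a ord0 j : nat)%:R.
(** Coordinate [j] contributes [x j ^+ 2] or [(N - x j) ^+ 2] to the squared distance. Writing these
    as midpoint plus or minus [dev j] isolates an independent random sign. *)
Let mean : R := \sum_j (x j ^+ 2 + (N%:R - x j) ^+ 2) / 2.
Let dev (j : 'I_d) : R := (x j ^+ 2 - (N%:R - x j) ^+ 2) / 2.

Lemma sqdist_vertex b :
  sqdist (vertex b) = mean + \sum_j dev j * (-1) ^+ b j.
Proof.
rewrite /mean -big_split; apply: eq_bigr => j _ /=.
by rewrite !mxE /dev -/(x j); case: (b j) => /=; rewrite ?expr1 ?expr0; field.
Qed.

(** [dev j] factors as [N * (2 * x j - N) / 2], and [2 * x j - N] lies between [-N] and [N]. *)
Lemma sqr_dev_le j : dev j ^+ 2 <= N%:R ^+ 4 / 4.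
Proof.
have x_ge0 : 0 <= x j by rewrite ler0n.
have x_le : x j <= N%:R by rewrite ler_nat -ltnS ltn_ord.
have -> : dev j ^+ 2 = N%:R ^+ 2 * (2 * x j - N%:R) ^+ 2 / 4.
  by rewrite /dev; field.
rewrite ler_pM2r ?invr_gt0 ?ltr0n // (_ : 4 = 2 + 2)%N // exprD.
by rewrite ler_wpM2l ?exprn_ge0 //; nra.
Qed.

Lemma sum_sqr_sqdist_sub_mean_le :
  \sum_(v in vertices d N) (sqdist v - mean) ^+ 2 <=
  (2 ^ d)%:R * (d%:R * (N%:R ^+ 4 / 4)).
Proof.
rewrite sum_vertices.
under eq_bigr do rewrite sqdist_vertex addrAC subrr add0r.
rewrite sum_sqr_signed_sum card_ord ler_wpM2l ?ler0n //.
apply: le_trans (ler_sum _ (fun j _ => sqr_dev_le j)) _.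
by rewrite sumr_const card_ord mulr_natl.
Qed.

Lemma sum_sqr_sqdist_sub_le :
  \sum_(p in setX (vertices d N) (vertices d N))
     (sqdist p.1 - sqdist p.2) ^+ 2 <=
  (2 ^ d)%:R ^+ 2 * d%:R * N%:R ^+ 4.
Proof.
set V := vertices d N; pose D v := (sqdist v - mean) ^+ 2.
(* The two sides differ by exactly the square of [sqdist p.1 + sqdist p.2 - 2 * mean]. *)
have sub_le p : (sqdist p.1 - sqdist p.2) ^+ 2 <= 2 * D p.1 + 2 * D p.2.
  by rewrite /D; have := sqr_ge0 (sqdist p.1 + sqdist p.2 - 2 * mean); lra.
apply: le_trans (ler_sum _ (fun p _ => sub_le p)) _.
have -> : \sum_(p in setX V V) (2 * D p.1 + 2 * D p.2) =
          4 * (2 ^ d)%:R * \sum_(v in V) D v.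
  under eq_bigl do rewrite inE.
  rewrite -(pair_big (mem V) (mem V) (fun u v => 2 * D u + 2 * D v)) /=.
  under eq_bigr do rewrite big_split /= sumr_const -mulr_sumr card_vertices.
  rewrite big_split /= sumr_const card_vertices sumrMnl -mulr_sumr.
  by move: (\sum_(v in V) D v) (2 ^ d)%N => s k; ring.
have := sum_sqr_sqdist_sub_mean_le; rewrite -/V -/D => D_le.
have := ler_wpM2l (ler0n R (4 * 2 ^ d)) D_le; rewrite natrM => /le_trans-> //.
by rewrite le_eqVlt; apply/orP; left; apply/eqP; field.
Qed.

(** Clearing the normalization, the square roots differ by more than [sqrt d * N * eps]; by
    [sqr_sqrt_sub_le] the square of this bounds the gap of the squared distances from below. *)
Lemma sqdist_sub_gt (eps : R) (u v : lattice d N) : (0 < d)%N -> 0 < eps ->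
  eps < `|ndist N (point R a) (point R u) - ndist N (point R a) (point R v)| ->
  (eps ^+ 2 * d%:R * N%:R ^+ 2) ^+ 2 <= (sqdist u - sqdist v) ^+ 2.
Proof.
move=> d_gt0 eps_gt0; rewrite /ndist -!/(sqdist _) -mulrBr normrM.
have sqdist_ge0 w : 0 <= sqdist w by apply: sumr_ge0 => j _; exact: sqr_ge0.
have c_gt0 : 0 < Num.sqrt d%:R * N%:R :> R.
  by rewrite mulr_gt0 ?sqrtr_gt0 ?ltr0n.
rewrite gtr0_norm ?invr_gt0 // ltr_pdivlMl // => lt_eps.
rewrite -[leRHS]real_normK ?num_real //.
rewrite ler_pXn2r ?nnegrE ?normr_ge0 ?mulr_ge0 ?ler0n ?(ltW eps_gt0) //.
apply: le_trans (sqr_sqrt_sub_le (sqdist_ge0 u) (sqdist_ge0 v)).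
have -> : eps ^+ 2 * d%:R * N%:R ^+ 2 = (Num.sqrt d%:R * N%:R * eps) ^+ 2.
  by rewrite !exprMn sqr_sqrtr ?ler0n //; ring.
rewrite -[leRHS]real_normK ?num_real // ler_pXn2r ?nnegrE ?normr_ge0 ?ltW //.
by rewrite mulr_gt0.
Qed.

(** Chebyshev: each far pair contributes at least [eps ^+ 4 * d ^+ 2 * N ^+ 4] to the sum bounded in
    [sum_sqr_sqdist_sub_le]. *)
Lemma card_far_le (eps : R) : (0 < d)%N -> 0 < eps ->
  #|triangles R a :\: near_isosceles a eps|%:R * (eps ^+ 4 * d%:R) <=
  (2 ^ d)%:R ^+ 2.
Proof.
move=> d_gt0 eps_gt0; set B := _ :\: _.
have dN_gt0 : 0 < d%:R * N%:R ^+ 4 :> R.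
  by rewrite mulr_gt0 ?exprn_gt0 ?ltr0n.
rewrite -(ler_pM2r dN_gt0) [leRHS]mulrA.
apply: le_trans sum_sqr_sqdist_sub_le.
set t := (eps ^+ 2 * d%:R * N%:R ^+ 2) ^+ 2.
have -> : #|B|%:R * (eps ^+ 4 * d%:R) * (d%:R * N%:R ^+ 4) = \sum_(p in B) t.
  by rewrite sumr_const -mulr_natl /t; ring.
have subB p : p \in B -> p \in setX (vertices d N) (vertices d N).
  by rewrite !inE => /andP[_ /andP[]].
rewrite [leRHS](big_setID B) /= (setIidPr _); last exact/subsetP.
rewrite -[leLHS]addr0 lerD ?sumr_ge0 // => [|p _]; last exact: sqr_ge0.
apply: ler_sum => p; rewrite inE [p \in near_isosceles _ _]inE.
by move=> /andP[far pT]; move: far; rewrite pT /= -ltNge; exact: sqdist_sub_gt.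
Qed.

(** * Counting degenerate triangles *)

Lemma card_degenerate_le :
  (#|setX (vertices d N) (vertices d N) :\: triangles R a| <= 3 * 2 ^ d)%N.
Proof.
set V := vertices d N; set D := _ :\: _.
have D_V p : p \in D -> (p.1 \in V) && (p.2 \in V).
  by rewrite inE => /andP[_]; rewrite inE.
have D_col p :
    p \in D -> ~~ is_triangle (point R a) (point R p.1) (point R p.2).
  by rewrite inE [_ \in triangles _ _]inE => /andP[+ pV]; rewrite pV.
(* The coordinate at [sep v] determines the position along the line [a v]. *)
pose sep (v : lattice d N) := [pick j | v ord0 j != a ord0 j].
(* The default [ord0] occurs only when [p.1 = a], a case put aside in [A]; being a legal vertex
   coordinate, it does not enlarge the range of [f]. *)
pose f (p : lattice d N * lattice d N) :=
  (p.1, if sep p.1 is Some j then p.2 ord0 j else ord0).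
pose A := [set p in D | p.1 == a].
have A_le : (#|A| <= 2 ^ d)%N.
  rewrite -card_vertices -[leqRHS]mul1n -(cards1 a) -cardsX subset_leq_card //.
  by apply/subsetP=> p; rewrite !inE => /andP[/andP[_ /andP[_ ->]] ->].
(* Off [A], collinearity makes [v - a] a multiple of [u - a], and the coordinate at [j], where
   [u - a] is nonzero, fixes the factor. *)
have f_inj : {in D :\: A &, injective f}.
  move=> [u v] [u' w] /setDP[uvD uvA] /setDP[uwD _] [eq_u] eq_sep.
  rewrite -{u'}eq_u in uwD eq_sep *; congr (_, _); move: eq_sep.
  have neq_ua : u != a by move: uvA; rewrite inE uvD.
  rewrite /f /sep; case: pickP => [j neq_j | eq_ua] /= => [eq_j|]; last first.
    by case/eqP: neq_ua; apply/rowP => j; have /negPn/eqP := eq_ua j.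
  have neq_pt : point R u ord0 j - point R a ord0 j != 0.
    by rewrite !mxE subr_eq0 eqr_nat.
  have u_neq0 : point R u - point R a != 0.
    apply: contraNneq neq_pt => /rowP/(_ j).
    by rewrite !mxE => ->.
  have [k eq_v] := dependent_rV_scale u_neq0 (D_col _ uvD).
  have [l eq_w] := dependent_rV_scale u_neq0 (D_col _ uwD).
  have eq_kl : k = l.
    apply: (mulIf neq_pt).
    have := congr1 (fun M : 'rV_d => M ord0 j) eq_v.
    have := congr1 (fun M : 'rV_d => M ord0 j) eq_w.
    by rewrite !mxE /= eq_j => <- <-.
  have /rowP eq_vw : point R v = point R w.
    by apply: (addIr (- point R a)); rewrite eq_v eq_w eq_kl.
  apply/rowP => i; apply/val_inj/eqP; have := eq_vw i.
  by rewrite !mxE => /eqP; rewrite eqr_nat.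
(* The values of [f] are a vertex paired with an end of the interval, hence the factor 2. *)
have DA_le : (#|D :\: A| <= 2 ^ d * 2)%N.
  have card_ends : #|[set ord0; ord_max : 'I_N.+1]| = 2%N.
    by rewrite cards2 -val_eqE /= eq_sym -lt0n N_gt0.
  rewrite -(card_in_imset f_inj) -card_vertices -card_ends -cardsX.
  apply/subset_leq_card/subsetP => _ /imsetP[p /setDP[pD _] ->].
  have /andP[p1V] := D_V p pD; rewrite [p.2 \in V]inE => /forallP p2V.
  by rewrite in_setX p1V /=; case: (sep p.1) => [j|]; rewrite !inE ?eqxx.
rewrite -(cardsID A D) (setIidPr _); first by lia.
by apply/subsetP => p; rewrite inE => /andP[].
Qed.

Lemma card_triangles_ge : (2 < d)%N ->
  ((2 ^ d) ^ 2 <= 2 * #|triangles R a|)%N.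
Proof.
move=> d_gt2; have := card_degenerate_le.
rewrite cardsD (setIidPr _); last first.
  by apply/subsetP=> p; rewrite inE => /andP[].
rewrite cardsX card_vertices.
(* With [k = 2 ^ d], the [3 * k] degenerate pairs are at most half of all [k ^ 2] pairs as soon as
   [k >= 6]. *)
have: (8 <= 2 ^ d)%N by rewrite -[8%N]/(2 ^ 3)%N leq_exp2l.
rewrite -mulnn leq_subLR; move: (2 ^ d)%N #|_| => k t k_ge8 kk_le.
by have := leq_mul k_ge8 (leqnn k); lia.
Qed.

End Vertices.

Theorem theorem1p1 (R : realType) (eps : R) (heps : 0 < eps) :
  exists d_eps : nat, forall d N : nat,
    (d_eps <= d)%N -> (1 <= d)%N -> (1 <= N)%N ->
    forall a : lattice d N,
      1 - eps <= proportion R (near_isosceles a eps) (triangles R a).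
Proof.
(* The 3 makes at least half of the pairs triangles. The other bound gives [2 <= eps ^+ 5 * d], so
   the far triangles, at most [2 * T / (eps ^+ 4 * d)] in number, are at most [eps * T]. *)
exists (maxn 3 (Num.truncn (2 / eps ^+ 5)).+1) => d N.
rewrite geq_max => /andP[d_gt2 d_large] d_gt0 N_gt0 a.
have d_ge : 2 <= eps ^+ 5 * d%:R.
  rewrite mulrC -ler_pdivrMr ?exprn_gt0 //; apply/ltW.
  by apply: lt_le_trans (truncnS_gt _) _; rewrite ler_nat.
have far_le := card_far_le N_gt0 a d_gt0 heps.
have := card_triangles_ge N_gt0 R a d_gt2; rewrite -(ler_nat R) natrX natrM.
move: far_le; rewrite cardsD (setIidPr _); last first.
  by apply/subsetP=> p; rewrite inE => /andP[].
have le_T : (#|near_isosceles a eps| <= #|triangles R a|)%N.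
  by apply/subset_leq_card/subsetP=> p; rewrite inE => /andP[].
rewrite natrB // /proportion.
set T : R := #|triangles R a|%:R; set I : R := #|near_isosceles a eps|%:R.
(* Chaining through [(2 ^ d) ^ 2] yields [(T - I) * (eps ^+ 4 * d) <= 2 * T]. *)
move=> /le_trans far_le /far_le {}far_le.
have T_gt0 : 0 < T.
  have := card_triangles_ge N_gt0 R a d_gt2; rewrite ltr0n !lt0n => le_T2.
  by apply: contraTneq le_T2 => ->; rewrite muln0 leqn0 !expn_eq0.
rewrite ler_pdivlMr // -subr_ge0.
have e4_gt0 : 0 < eps ^+ 4 * d%:R by rewrite mulr_gt0 ?exprn_gt0 ?ltr0n.
rewrite -(pmulr_lge0 _ e4_gt0).
have := ler_wpM2r (ltW T_gt0) d_ge.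
move: far_le.
suff -> : (I - (1 - eps) * T) * (eps ^+ 4 * d%:R) =
  eps ^+ 5 * d%:R * T - (T - I) * (eps ^+ 4 * d%:R) by lra.
by ring.
Qed.
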